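(* Let $\mathsf{C}$ be a quasi-Markov category such that: (1) $\mathsf{C}$ is positive and $\sigma$-continuous; (2) countable Kolmogorov products exist in $\mathsf{C}$; (3) all balanced idempotents in $\mathsf{C}$ split; (4) every object $X$ of $\mathsf{C}$ has an empirical sampling morphism $\mathsf{es}: X^{\mathbb{N}} \to X$. Then $\mathsf{C}$ is an observationally representable quasi-Markov category. In particular, for every object $X$ there is a distribution object $PX$ and a sampling morphism $\mathsf{samp}: PX \to X$.
   Context: Notation: $\mathbb{N}=\{1,2,3,\ldots\}$; composition is written by juxtaposition; coherence isomorphisms are suppressed. A CD category is a symmetric monoidal category $(\mathsf{C},\otimes,I)$ in which every object $X$ carries a distinguished commutative comonoid structure $\mathrm{copy}_X:X\to X\otimes X$, $\mathrm{del}_X:X\to I$, compatible with the tensor product (these are not required to be natural). A morphism $f:A\to X$ is total if $\mathrm{del}_X f=\mathrm{del}_A$; quasi-total if $f=(f\otimes \mathrm{del}_X f)\,\mathrm{copy}_A$; copyable if $\mathrm{copy}_X f=(f\otimes f)\,\mathrm{copy}_A$; deterministic if total and copyable. A quasi-Markov category is a CD category in which every morphism is quasi-total. $\mathsf{C}_{\rm cop}$ is the wide subcategory of copyable morphisms. $\mathsf{C}$ is positive if for all $f:X\to Y$, $g:Y\to Z$ with $gf$ copyable one has $(\mathrm{id}_Y\otimes g)\,\mathrm{copy}_Y f=(f\otimes gf)\,\mathrm{copy}_X$. The domain of $f:A\to X$ is $\mathrm{dom}(f)=(\mathrm{id}_A\otimes \mathrm{del}_X f)\,\mathrm{copy}_A:A\to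 A$. For $f,g:A\to X$, write $f\sqsupseteq g$ ($f$ extends $g$) if $f\,\mathrm{dom}(g)=g$; this is a partial order on hom-sets. A positive quasi-Markov category is $\sigma$-continuous if, with respect to $\sqsupseteq$, every descending sequence $f_1\sqsupseteq f_2\sqsupseteq\cdots$ of morphisms $X\to Y$ has a meet (greatest lower bound) $\bigwedge_n f_n$, and these meets are preserved by pre- and post-composition and by tensoring with arbitrary morphisms. A Kolmogorov product $\bigotimes_{i\in\mathbb{N}}X_i$ of a sequence of objects is a limit in $\mathsf{C}$ of the diagram $\cdots\to X_1\otimes\cdots\otimes X_n\to\cdots\to X_1\otimes X_2\to X_1$ (arrows delete the last factor) whose cone components $\pi_n:\bigotimes_{i\in\mathbb{N}} X_i\to X_1\otimes\cdots\otimes X_n$ are deterministic and which is preserved by $-\otimes Y$ for every object $Y$. $X^{\mathbb{N}}$ denotes the Kolmogorov power (all $X_i=X$). For $f:A\to X$, $f^{(n)}:A\to X^{\otimes n}$ is the $n$-fold copy of $A$ followed by $f^{\otimes n}$, and $f^{(\mathbb{N})}:A\to X^{\mathbb{N}}$ is the unique morphism with $\pi_n f^{(\mathbb{N})}=f^{(n)}$ for all $n$. For a finite permutation $\sigma$ of $\mathbb{N}$ (a bijection fixing all but finitely many elements), $X^\sigma:X^{\mathbb{N}}\to X^{\mathbb{N}}$ is the induced deterministic morphism permuting the factors (its $i$-th output is its $\sigma(i)$-th input). A morphism $f:A\to X^{\mathbb{N}}\otimes Y$ is exchangeable in the first factor if $(X^\sigma\otimes \mathrm{id}_Y)f=f$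 for every finite permutation $\sigma$. An empirical sampling morphism for $X$ is a morphism $\mathsf{es}:X^{\mathbb{N}}\to X$ such that (i) $\mathsf{es}\,X^\sigma=\mathsf{es}$ for every finite permutation $\sigma$ of $\mathbb{N}$, and (ii) for all objects $A,Y$ and every $f:A\to X^{\mathbb{N}}\otimes Y$ exchangeable in the first factor, $(\mathsf{es}^{(\mathbb{N})}\otimes\mathrm{id}_Y)f=f$. An idempotent $e:X\to X$ is balanced if $(\mathrm{id}_X\otimes e)\,\mathrm{copy}_X e=(e\otimes \mathrm{id}_X)\,\mathrm{copy}_X e$. It splits if there are $\pi:X\to E$, $\iota:E\to X$ with $e=\iota\pi$ and $\pi\iota=\mathrm{id}_E$. A distribution object for $X$ is an object $PX$ with bijections $\mathsf{C}(A,X)\cong\mathsf{C}_{\rm cop}(A,PX)$ natural in $A\in\mathsf{C}_{\rm cop}$; the sampling morphism $\mathsf{samp}:PX\to X$ is the counterpart of $\mathrm{id}_{PX}$. $\mathsf{C}$ is representable if every object has a distribution object, and observationally representable if moreover for every $X$ the family $(\mathsf{samp}^{(n)}:PX\to X^{\otimes n})_{n\in\mathbb{N}}$ is jointly monic. *)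

(* Defs.v *)
From mathcomp Require Import ssreflect ssrfun ssrbool eqtype ssrnat.

Set Implicit Arguments.
Unset Strict Implicit.
Unset Printing Implicit Defensive.

Declare Scope cat_scope.
Delimit Scope cat_scope with cat.
Local Open Scope cat_scope.

Reserved Notation "A ~> B" (at level 70, no associativity).
Reserved Notation "g ∘ f" (at level 40, left associativity).
Reserved Notation "A ⊗ B" (at level 38, left associativity).
Reserved Notation "f ⊠ g" (at level 38, left associativity).

Record category := Category {
  ob :> Type;
  hom : ob -> ob -> Type;
  idm : forall A, hom A A;
  compm : forall A B D, hom B D -> hom A B -> hom A D;
  compmA : forall A B D E (h : hom D E) (g : hom B D) (f : hom A B),
    compm h (compm g f) = compm (compm h g) f;
  comp1m : forall A B (f : hom A B), compm (idm B) f = f;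
  compm1 : forall A B (f : hom A B), compm f (idm A) = f }.

Notation "A ~> B" := (hom A B) : cat_scope.
Notation "g ∘ f" := (compm g f) : cat_scope.
Arguments idm {c} A.

(* Not assumed strict: the coherence isomorphisms are part of the data. *)
Record sym_monoidal := SymMonoidal {
  smc_cat :> category;
  unit_ob : smc_cat;
  tensor : smc_cat -> smc_cat -> smc_cat;
  tensorm : forall A B A' B' : smc_cat,
    A ~> A' -> B ~> B' -> tensor A B ~> tensor A' B';
  assoc : forall A B D : smc_cat,
    tensor (tensor A B) D ~> tensor A (tensor B D);
  assoc_inv : forall A B D : smc_cat,
    tensor A (tensor B D) ~> tensor (tensor A B) D;
  lunit : forall A : smc_cat, tensor unit_ob A ~> A;
  lunit_inv : forall A : smc_cat, A ~> tensor unit_ob A;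
  runit : forall A : smc_cat, tensor A unit_ob ~> A;
  runit_inv : forall A : smc_cat, A ~> tensor A unit_ob;
  braid : forall A B : smc_cat, tensor A B ~> tensor B A;

  tensorm1 : forall A B : smc_cat,
    tensorm (idm A) (idm B) = idm (tensor A B);
  tensorm_comp : forall (A B A' B' A'' B'' : smc_cat)
      (f' : A' ~> A'') (f : A ~> A') (g' : B' ~> B'') (g : B ~> B'),
    tensorm (f' ∘ f) (g' ∘ g) = tensorm f' g' ∘ tensorm f g;

  assocK : forall A B D, assoc_inv A B D ∘ assoc A B D = idm _;
  assoc_invK : forall A B D, assoc A B D ∘ assoc_inv A B D = idm _;
  lunitK : forall A, lunit_inv A ∘ lunit A = idm _;
  lunit_invK : forall A, lunit A ∘ lunit_inv A = idm _;
  runitK : forall A, runit_inv A ∘ runit A = idm _;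
  runit_invK : forall A, runit A ∘ runit_inv A = idm _;

  assoc_nat : forall (A B D A' B' D' : smc_cat)
      (f : A ~> A') (g : B ~> B') (h : D ~> D'),
    assoc A' B' D' ∘ tensorm (tensorm f g) h
    = tensorm f (tensorm g h) ∘ assoc A B D;
  lunit_nat : forall (A B : smc_cat) (f : A ~> B),
    lunit B ∘ tensorm (idm unit_ob) f = f ∘ lunit A;
  runit_nat : forall (A B : smc_cat) (f : A ~> B),
    runit B ∘ tensorm f (idm unit_ob) = f ∘ runit A;
  braid_nat : forall (A B A' B' : smc_cat) (f : A ~> A') (g : B ~> B'),
    braid A' B' ∘ tensorm f g = tensorm g f ∘ braid A B;

  triangle : forall A B : smc_cat,
    tensorm (idm A) (lunit B) ∘ assoc A unit_ob B = tensorm (runit A) (idm B);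
  pentagon : forall A B D E : smc_cat,
    tensorm (idm A) (assoc B D E) ∘ assoc A (tensor B D) E
      ∘ tensorm (assoc A B D) (idm E)
    = assoc A B (tensor D E) ∘ assoc (tensor A B) D E;
  hexagon : forall A B D : smc_cat,
    assoc B D A ∘ braid A (tensor B D) ∘ assoc A B D
    = tensorm (idm B) (braid A D) ∘ assoc B A D ∘ tensorm (braid A B) (idm D);
  braidK : forall A B : smc_cat, braid B A ∘ braid A B = idm (tensor A B) }.

Notation "A ⊗ B" := (tensor A B) : cat_scope.
Notation "f ⊠ g" := (tensorm f g) : cat_scope.
Arguments unit_ob {s}.
Arguments assoc {s} A B D.
Arguments assoc_inv {s} A B D.
Arguments lunit {s} A.
Arguments lunit_inv {s} A.
Arguments runit {s} A.
Arguments runit_inv {s} A.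
Arguments braid {s} A B.

Definition interchange (M : sym_monoidal) (A B D E : M) :
    (A ⊗ B) ⊗ (D ⊗ E) ~> (A ⊗ D) ⊗ (B ⊗ E) :=
  assoc_inv A D (B ⊗ E)
  ∘ (idm A ⊠ (assoc D B E ∘ (braid B D ⊠ idm E) ∘ assoc_inv B D E))
  ∘ assoc A B (D ⊗ E).

(* In the strict case copy_unit and del_unit follow from compatibility with
   the binary tensor product; without strictness they have to be required. *)
Record cd_category := CDCategory {
  cd_smc :> sym_monoidal;
  copy : forall X : cd_smc, X ~> X ⊗ X;
  del : forall X : cd_smc, X ~> unit_ob;
  copyA : forall X,
    assoc X X X ∘ (copy X ⊠ idm X) ∘ copy X = (idm X ⊠ copy X) ∘ copy X;
  copy_dell : forall X, lunit X ∘ (del X ⊠ idm X) ∘ copy X = idm X;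
  copy_delr : forall X, runit X ∘ (idm X ⊠ del X) ∘ copy X = idm X;
  copyC : forall X, braid X X ∘ copy X = copy X;
  copy_tensor : forall X Y,
    copy (X ⊗ Y) = interchange X X Y Y ∘ (copy X ⊠ copy Y);
  del_tensor : forall X Y,
    del (X ⊗ Y) = lunit unit_ob ∘ (del X ⊠ del Y);
  copy_unit : copy unit_ob = lunit_inv unit_ob;
  del_unit : del unit_ob = idm unit_ob }.

Arguments copy {c} X.
Arguments del {c} X.

Section CD.
Variable C : cd_category.
Implicit Types A B X Y Z : C.

Definition total_mor A X (f : A ~> X) : Prop := del X ∘ f = del A.

Definition quasi_total A X (f : A ~> X) : Prop :=
  f = runit X ∘ (f ⊠ (del X ∘ f)) ∘ copy A.

Definition copyable A X (f : A ~> X) : Prop :=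
  copy X ∘ f = (f ⊠ f) ∘ copy A.

Definition deterministic A X (f : A ~> X) : Prop := total_mor f /\ copyable f.

Definition positive : Prop :=
  forall X Y Z (f : X ~> Y) (g : Y ~> Z), copyable (g ∘ f) ->
    (idm Y ⊠ g) ∘ copy Y ∘ f = (f ⊠ (g ∘ f)) ∘ copy X.

Definition dom A X (f : A ~> X) : A ~> A :=
  runit A ∘ (idm A ⊠ (del X ∘ f)) ∘ copy A.

Definition extends A X (f g : A ~> X) : Prop := f ∘ dom g = g.

Definition descending A X (f : nat -> A ~> X) : Prop :=
  forall n, extends (f n) (f n.+1).

Definition is_meet A X (f : nat -> A ~> X) (m : A ~> X) : Prop :=
  (forall n, extends (f n) m) /\
  (forall l, (forall n, extends (f n) l) -> extends m l).

Definition sigma_continuous : Prop :=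
  forall X Y (f : nat -> X ~> Y), descending f ->
    (exists m, is_meet f m) /\
    (forall m, is_meet f m ->
      [/\ forall W (h : W ~> X), is_meet (fun n => f n ∘ h) (m ∘ h),
          forall Z (g : Y ~> Z), is_meet (fun n => g ∘ f n) (g ∘ m),
          forall W Z (g : W ~> Z), is_meet (fun n => f n ⊠ g) (m ⊠ g)
        & forall W Z (g : W ~> Z), is_meet (fun n => g ⊠ f n) (g ⊠ m)]).

Definition idempotent_mor X (e : X ~> X) : Prop := e ∘ e = e.

Definition balanced X (e : X ~> X) : Prop :=
  (idm X ⊠ e) ∘ copy X ∘ e = (e ⊠ idm X) ∘ copy X ∘ e.

Definition splits X (e : X ~> X) : Prop :=
  exists (E : C) (p : X ~> E) (i : E ~> X), e = i ∘ p /\ p ∘ i = idm E.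

Definition jointly_monic A (X : nat -> C) (f : forall n, A ~> X n) : Prop :=
  forall W (g h : W ~> A), (forall n, f n ∘ g = f n ∘ h) -> g = h.

(* Sequences are indexed from 0, and [prefix X n], [ncopy A n] and
   [tuple_mor f n] below have n + 1 factors. *)
Fixpoint prefix (X : nat -> C) (n : nat) : C :=
  if n is m.+1 then prefix X m ⊗ X m.+1 else X 0.

Definition prefix_del (X : nat -> C) (n : nat) : prefix X n.+1 ~> prefix X n :=
  runit (prefix X n) ∘ (idm (prefix X n) ⊠ del (X n.+1)).

Definition prefix_last (X : nat -> C) (n : nat) : prefix X n ~> X n :=
  match n return prefix X n ~> X n with
  | 0 => idm (X 0)
  | m.+1 => lunit (X m.+1) ∘ (del (prefix X m) ⊠ idm (X m.+1))
  end.

Fixpoint prefix_map (X Y : nat -> C) (f : forall i, X i ~> Y i) (n : nat) :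
    prefix X n ~> prefix Y n :=
  match n return prefix X n ~> prefix Y n with
  | 0 => f 0
  | m.+1 => prefix_map f m ⊠ f m.+1
  end.

Fixpoint ncopy A (n : nat) : A ~> prefix (fun _ => A) n :=
  match n return A ~> prefix (fun _ => A) n with
  | 0 => idm A
  | m.+1 => (ncopy A m ⊠ idm A) ∘ copy A
  end.

Definition tuple_mor A (X : nat -> C) (f : forall i, A ~> X i) (n : nat) :
    A ~> prefix X n :=
  prefix_map f n ∘ ncopy A n.

Definition fpow A X (f : A ~> X) (n : nat) : A ~> prefix (fun _ => X) n :=
  tuple_mor (fun _ => f) n.

Definition is_cone (D : nat -> C) (d : forall n, D n.+1 ~> D n)
    A (c : forall n, A ~> D n) : Prop :=
  forall n, d n ∘ c n.+1 = c n.

Record seq_limit (D : nat -> C) (d : forall n, D n.+1 ~> D n)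
    (L : C) (p : forall n, L ~> D n) := SeqLimit {
  lim_cone : is_cone d p;
  lim_lift : forall A (c : forall n, A ~> D n), is_cone d c -> A ~> L;
  lim_liftE : forall A (c : forall n, A ~> D n) (cc : is_cone d c) n,
    p n ∘ lim_lift cc = c n;
  lim_lift_uniq : forall A (u v : A ~> L),
    (forall n, p n ∘ u = p n ∘ v) -> u = v }.

Record kolmogorov_product (X : nat -> C) := KolmogorovProduct {
  kobj :> C;
  kproj : forall n, kobj ~> prefix X n;
  kproj_det : forall n, deterministic (kproj n);
  klim : seq_limit (prefix_del X) kproj;
  klim_tensor : forall Y,
    seq_limit (fun n => prefix_del X n ⊠ idm Y) (fun n => kproj n ⊠ idm Y) }.

Definition kolmogorov_power X := kolmogorov_product (fun _ => X).

Definition kmarg (X : nat -> C) (K : kolmogorov_product X) (i : nat) :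
    K ~> X i :=
  prefix_last X i ∘ kproj K i.

Lemma tensormE A B A' B' A'' B'' (f' : A' ~> A'') (f : A ~> A')
    (g' : B' ~> B'') (g : B ~> B') :
  (f' ⊠ g') ∘ (f ⊠ g) = (f' ∘ f) ⊠ (g' ∘ g).
Proof. by rewrite tensorm_comp. Qed.

Lemma tupleS A (X : nat -> C) (f : forall i, A ~> X i) n :
  tuple_mor f n.+1 = (tuple_mor f n ⊠ f n.+1) ∘ copy A.
Proof. by rewrite /tuple_mor /= compmA tensormE compm1. Qed.

Lemma prefix_del_tupleS A (X : nat -> C) (f : forall i, A ~> X i) n :
  prefix_del X n ∘ tuple_mor f n.+1
  = runit _ ∘ (tuple_mor f n ⊠ (del _ ∘ f n.+1)) ∘ copy A.
Proof.
by rewrite tupleS /prefix_del compmA -[_ ∘ (_ ⊠ f _)]compmA tensormE comp1m.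
Qed.

Lemma tuple_total_cone A (X : nat -> C) (f : forall i, A ~> X i) :
  (forall i, total_mor (f i)) -> is_cone (prefix_del X) (tuple_mor f).
Proof.
move=> ft n; rewrite prefix_del_tupleS ft.
rewrite -[tuple_mor f n]compm1 -[del A]comp1m tensorm_comp compmA runit_nat.
by rewrite -!compmA [runit A ∘ _]compmA copy_delr !compm1.
Qed.

Lemma runit_tensor A B : runit (A ⊗ B) = (idm A ⊠ runit B) ∘ assoc A B unit_ob.
Proof.
have faith U V (u v : U ~> V) : u ⊠ idm unit_ob = v ⊠ idm unit_ob -> u = v.
  move=> uv; rewrite -[u]compm1 -[v]compm1 -(runit_invK U) !compmA.
  by rewrite -!runit_nat uv.
apply: faith; rewrite -[LHS]comp1m -[RHS]comp1m -(assocK A B unit_ob).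
rewrite -!compmA; congr (_ ∘ _).
rewrite -triangle compmA -[idm (A ⊗ B)]tensorm1 assoc_nat -compmA -pentagon.
rewrite !compmA tensormE comp1m triangle.
by rewrite -assoc_nat -compmA tensormE comp1m.
Qed.

Lemma fpow_cone A X (f : A ~> X) :
  quasi_total f -> is_cone (prefix_del (fun _ => X)) (fpow f).
Proof.
move=> qf n; rewrite /fpow prefix_del_tupleS.
elim: n => [|n _]; first by rewrite /tuple_mor /= compm1 -qf.
rewrite tupleS; set t := tuple_mor _ n; set s := del X ∘ f.
transitivity ((t ⊠ (runit X ∘ (f ⊠ s) ∘ copy A)) ∘ copy A); last by rewrite -qf.
rewrite -[s in LHS]compm1 tensorm_comp runit_tensor.
rewrite -!compmA [assoc _ _ _ ∘ _]compmA assoc_nat.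
rewrite -!compmA [assoc A A A ∘ _]compmA copyA.
by rewrite !compmA tensormE comp1m tensormE compm1 -!compmA.
Qed.

Lemma total_comp A B X (g : B ~> X) (f : A ~> B) :
  total_mor g -> total_mor f -> total_mor (g ∘ f).
Proof. by rewrite /total_mor compmA => -> ->. Qed.

Lemma total_id A : total_mor (idm A).
Proof. by rewrite /total_mor compm1. Qed.

Lemma total_prefix_last (X : nat -> C) n : total_mor (prefix_last X n).
Proof.
case: n => [|n] /=; first exact: total_id.
rewrite /total_mor compmA -lunit_nat -compmA tensormE comp1m compm1.
by rewrite [RHS]del_tensor.
Qed.

Lemma kmarg_total (X : nat -> C) (K : kolmogorov_product X) i :
  total_mor (kmarg K i).
Proof.
exact: total_comp (total_prefix_last X i) (proj1 (kproj_det K i)).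
Qed.

(* The i-th output is the (s i)-th input; copying the source is harmless here
   because the marginals of a Kolmogorov product are deterministic. *)
Definition kperm X (K : kolmogorov_power X) (s : nat -> nat) : K ~> K :=
  lim_lift (klim K)
    (tuple_total_cone (f := fun i => kmarg K (s i))
       (fun i => kmarg_total K (s i))).

Definition exchangeable X (K : kolmogorov_power X) A Y (f : A ~> K ⊗ Y) : Prop :=
  forall s : nat -> nat, bijective s ->
    (exists N, forall i, N <= i -> s i = i) ->
    (kperm K s ⊠ idm Y) ∘ f = f.

Lemma copyable_id A : copyable (idm A).
Proof. by rewrite /copyable compm1 tensorm1 comp1m. Qed.

Lemma copyable_comp A B X (g : B ~> X) (f : A ~> B) :
  copyable g -> copyable f -> copyable (g ∘ f).
Proof.
by rewrite /copyable => cg cf; rewrite compmA cg -compmA cf compmA tensormE.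
Qed.

Definition cop_hom A X := {f : A ~> X | copyable f}.

Definition cop_id A : cop_hom A A := exist _ (idm A) (copyable_id A).

Definition cop_comp A B X (g : cop_hom B X) (f : cop_hom A B) : cop_hom A X :=
  exist _ (sval g ∘ sval f) (copyable_comp (svalP g) (svalP f)).

Record distribution_object X := DistributionObject {
  dobj :> C;
  sharp : forall A, A ~> X -> cop_hom A dobj;
  flat : forall A, cop_hom A dobj -> A ~> X;
  sharpK : forall A, cancel (@sharp A) (@flat A);
  flatK : forall A, cancel (@flat A) (@sharp A);
  sharp_nat : forall A B (f : B ~> X) (h : cop_hom A B),
    sharp (f ∘ sval h) = cop_comp (sharp f) h }.

Definition samp X (PX : distribution_object X) : PX ~> X :=
  flat (cop_id PX).

Definition representable : Prop :=
  forall X, inhabited (distribution_object X).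

(* Distribution objects are unique up to isomorphism compatible with [samp],
   so that the choice of PX does not matter. *)
Definition observationally_representable : Prop :=
  representable /\
  forall X (PX : distribution_object X), jointly_monic (fpow (samp PX)).

End CD.

Record quasi_markov_category := QuasiMarkovCategory {
  qm_cd :> cd_category;
  qm_quasi_total : forall (A X : qm_cd) (f : A ~> X), quasi_total f }.

Section QuasiMarkov.
Variable C : quasi_markov_category.
Implicit Types A X Y : C.

(* The morphism written f^(N). *)
Definition kpow A X (K : kolmogorov_power X) (f : A ~> X) : A ~> K :=
  lim_lift (klim K) (fpow_cone (qm_quasi_total f)).

Definition empirical_sampling X (K : kolmogorov_power X) (es : K ~> X) : Prop :=
  (forall s : nat -> nat, bijective s ->
    (exists N, forall i, N <= i -> s i = i) -> es ∘ kperm K s = es) /\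
  (forall A Y (f : A ~> K ⊗ Y), exchangeable f ->
    (kpow K es ⊠ idm Y) ∘ f = f).

End QuasiMarkov.

(* Main.v *)
From mathcomp Require Import ssreflect ssrfun ssrbool eqtype ssrnat.
From Stdlib Require Import ProofIrrelevance.
Require Import Defs.
Local Open Scope cat_scope.

Set Implicit Arguments.
Unset Strict Implicit.
Unset Printing Implicit Defensive.

(** The distribution object of X is obtained by splitting one idempotent on the
    Kolmogorov power K = X^N, namely e = es^(N): it sends a sequence to i.i.d.
    samples from its empirical distribution.

    The defining property of es says that e absorbs every exchangeable morphism
    into K. Any f^(N) is exchangeable, since permuting i.i.d. copies changes
    nothing (tuple_perm, kperm_kpow); hence e f^(N) = f^(N), and in particular
    e is idempotent. Three facts carry the proof.

    - e is balanced (balanced_kpow_es): the invariance of es under permutations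
      makes (id ⊠ e) copy e exchangeable, so both (id ⊠ e) copy e and, by
      symmetry, (e ⊠ id) copy e are equal to (e ⊠ e) copy e. Therefore e splits,
      as e = i p with p i = id, through an object E.

    - e is strong, (e ⊠ e) copy e = (e ⊠ e) copy (strong_kpow_es): the finite
      marginals of (e ⊠ e) copy are blocks of i.i.d. samples, that is, finite
      marginals of e itself up to reassociation (fpow_pair), and e e = e.

    - p is copyable (copyable_retraction): since p i = id is copyable,
      positivity gives copy_E = (p ⊠ p) copy i, and strength then allows the
      factor e = i p in copy_E p = (p ⊠ p) copy e to be dropped.

    Put sam = (first marginal) i : E -> X. Because p is copyable and sam p = es,
    one has sam^(N) p = es^(N) = i p, so sam^(N) = i (kpow_sam). The bijection
    of the distribution object sends f : A -> X to p f^(N), which is copyable by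
    the same block argument as for strength (copyable_sharp), and a copyable h
    to sam h; the two are mutually inverse because i p f^(N) = f^(N) and
    p (sam h)^(N) = p sam^(N) h = p i h = h. Finally the sam^(n) are the finite
    marginals of the split monomorphism i, so they are jointly monic; any other
    distribution object of X is isomorphic to E over X, so this passes to it. *)

(** * Pairing in copy-discard categories *)

Section CopyDiscard.
Variable C : cd_category.
Implicit Types A B D X Y Z W : C.

(** Pairing is natural only with respect to copyable precomposition, but
    associativity, symmetry and naturality on the output side hold for all
    morphisms; computing with these laws replaces string diagrams and coherence
    of the monoidal structure. *)
Definition pair_mor A X Y (f : A ~> X) (g : A ~> Y) : A ~> X ⊗ Y :=
  (f ⊠ g) ∘ copy A.

Lemma tensor_pair A X Y X' Y' (u : X ~> X') (v : Y ~> Y')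
    (f : A ~> X) (g : A ~> Y) :
  (u ⊠ v) ∘ pair_mor f g = pair_mor (u ∘ f) (v ∘ g).
Proof. by rewrite /pair_mor compmA tensormE. Qed.

Lemma braid_pair A X Y (f : A ~> X) (g : A ~> Y) :
  braid X Y ∘ pair_mor f g = pair_mor g f.
Proof. by rewrite /pair_mor compmA braid_nat -compmA copyC. Qed.

Lemma assoc_pair A X Y Z (f : A ~> X) (g : A ~> Y) (h : A ~> Z) :
  assoc X Y Z ∘ pair_mor (pair_mor f g) h = pair_mor f (pair_mor g h).
Proof.
rewrite /pair_mor -[h in LHS]compm1 tensorm_comp !compmA assoc_nat.
by rewrite -!compmA [assoc A A A ∘ _]compmA copyA !compmA tensormE compm1.
Qed.

Lemma assoc_inv_pair A X Y Z (f : A ~> X) (g : A ~> Y) (h : A ~> Z) :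
  assoc_inv X Y Z ∘ pair_mor f (pair_mor g h) = pair_mor (pair_mor f g) h.
Proof. by rewrite -assoc_pair compmA assocK comp1m. Qed.

Lemma interchange_pair A X Y Z W (f : A ~> X) (g : A ~> Y) (h : A ~> Z)
    (k : A ~> W) :
  interchange X Y Z W ∘ pair_mor (pair_mor f g) (pair_mor h k)
  = pair_mor (pair_mor f h) (pair_mor g k).
Proof.
rewrite /interchange -!compmA assoc_pair tensor_pair comp1m.
rewrite -!compmA assoc_inv_pair tensor_pair braid_pair comp1m assoc_pair.
exact: assoc_inv_pair.
Qed.

Lemma interchange_nat A B D W A' B' D' W' (f : A ~> A') (g : B ~> B')
    (h : D ~> D') (k : W ~> W') :
  interchange A' B' D' W' ∘ ((f ⊠ g) ⊠ (h ⊠ k))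
  = ((f ⊠ h) ⊠ (g ⊠ k)) ∘ interchange A B D W.
Proof.
have assoc_inv_nat U V Z U' V' Z' (u : U ~> U') (v : V ~> V') (z : Z ~> Z') :
    assoc_inv U' V' Z' ∘ (u ⊠ (v ⊠ z)) = ((u ⊠ v) ⊠ z) ∘ assoc_inv U V Z.
  rewrite -[LHS]compm1 -(assoc_invK U V Z) compmA -[_ ∘ _ ∘ assoc _ _ _]compmA.
  by rewrite -assoc_nat compmA assocK comp1m.
have braid_id_nat : (braid B' D' ⊠ idm W') ∘ ((g ⊠ h) ⊠ k)
    = ((h ⊠ g) ⊠ k) ∘ (braid B D ⊠ idm W).
  by rewrite !tensormE braid_nat comp1m compm1.
have swap_nat : assoc D' B' W' ∘ (braid B' D' ⊠ idm W') ∘ assoc_inv B' D' W'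
      ∘ (g ⊠ (h ⊠ k))
    = (h ⊠ (g ⊠ k)) ∘ (assoc D B W ∘ (braid B D ⊠ idm W) ∘ assoc_inv B D W).
  rewrite -compmA assoc_inv_nat compmA -[_ ∘ _ ∘ ((g ⊠ h) ⊠ k)]compmA.
  by rewrite braid_id_nat compmA assoc_nat !compmA.
rewrite /interchange -[LHS]compmA assoc_nat compmA.
rewrite -[_ ∘ _ ∘ (f ⊠ _)]compmA tensormE swap_nat comp1m -[f in LHS]compm1.
by rewrite tensorm_comp compmA assoc_inv_nat !compmA.
Qed.

Lemma pair_comp A B X Y (f : B ~> X) (g : B ~> Y) (h : A ~> B) :
  copyable h -> pair_mor f g ∘ h = pair_mor (f ∘ h) (g ∘ h).
Proof. by move=> ch; rewrite /pair_mor -compmA ch tensor_pair. Qed.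

Lemma copyable_pair A X Y (f : A ~> X) (g : A ~> Y) :
  copyable f -> copyable g -> copyable (pair_mor f g).
Proof.
move=> cf cg; rewrite /copyable copy_tensor -compmA tensor_pair cf cg.
rewrite -/(pair_mor f f) -/(pair_mor g g) interchange_pair.
by [].
Qed.

(** The unitors are themselves pairings with [del]. This turns the coherence
    facts about units used below into consequences of the comonoid laws. *)
Lemma lunit_invE X : lunit_inv X = pair_mor (del X) (idm X).
Proof.
rewrite -[RHS]comp1m -lunitK -compmA [lunit X ∘ _]compmA copy_dell.
by rewrite compm1.
Qed.

Lemma runit_invE X : runit_inv X = pair_mor (idm X) (del X).
Proof.
rewrite -[RHS]comp1m -runitK -compmA [runit X ∘ _]compmA copy_delr.
by rewrite compm1.
Qed.

Lemma runit_inv_nat X Y (f : X ~> Y) :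
  (f ⊠ idm unit_ob) ∘ runit_inv X = runit_inv Y ∘ f.
Proof.
by rewrite -[LHS]comp1m -runitK -!compmA [runit Y ∘ _]compmA runit_nat -compmA
           runit_invK compm1.
Qed.

Lemma copyable_del X : copyable (del X).
Proof.
rewrite /copyable copy_unit -/(pair_mor (del X) (del X)).
have -> : pair_mor (del X) (del X) = (idm unit_ob ⊠ del X) ∘ lunit_inv X.
  by rewrite lunit_invE tensor_pair comp1m compm1.
rewrite -[LHS]compm1 -(lunit_invK X) compmA -[_ ∘ _ ∘ lunit X]compmA.
by rewrite -lunit_nat compmA lunitK comp1m.
Qed.

Lemma copyable_inv X Y (f : X ~> Y) (g : Y ~> X) :
  g ∘ f = idm X -> f ∘ g = idm Y -> copyable f -> copyable g.
Proof.
move=> gf fg cf; rewrite /copyable -[LHS]comp1m -tensorm1 -gf tensorm_comp.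
by rewrite -compmA [(f ⊠ f) ∘ _]compmA -cf -[copy Y ∘ f ∘ _]compmA fg compm1.
Qed.

Lemma copyable_lunit X : copyable (lunit X).
Proof.
apply: (copyable_inv (lunit_invK X) (lunitK X)).
by rewrite lunit_invE; apply: copyable_pair (copyable_del _) (copyable_id _).
Qed.

Lemma copyable_tensor A B X Y (f : A ~> X) (g : B ~> Y) :
  copyable f -> copyable g -> copyable (f ⊠ g).
Proof.
move=> cf cg; rewrite /copyable !copy_tensor -compmA tensormE cf cg.
by rewrite tensorm_comp compmA interchange_nat compmA.
Qed.

Lemma copyable_prefix_last (X : nat -> C) n : copyable (prefix_last X n).
Proof.
case: n => [|n] /=; first exact: copyable_id.
apply: copyable_comp (copyable_lunit _) _.
exact: copyable_tensor (copyable_del _) (copyable_id _).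
Qed.

(** On the unit object [copy] is invertible, so commutativity of [copy] forces
    the braiding to be trivial. *)
Lemma braid_unit : braid unit_ob unit_ob = idm (unit_ob ⊗ unit_ob : C).
Proof.
rewrite -[LHS]compm1 -lunitK compmA -copy_unit copyC copy_unit.
by rewrite lunitK.
Qed.

Lemma interchange_unit A B :
  interchange A unit_ob unit_ob B = idm (_ : C).
Proof.
rewrite /interchange braid_unit tensorm1 compm1 assoc_invK tensorm1 compm1.
exact: assocK.
Qed.

(** A prefix is recovered from its two projections: on the projections the
    middle exchange takes place between two unit objects, where it is trivial. *)
Lemma pair_del_last (X : nat -> C) n :
  pair_mor (prefix_del X n) (prefix_last X n.+1) = idm _.
Proof.
rewrite /pair_mor /prefix_del /= copy_tensor tensorm_comp -compmA.
rewrite [((_ ⊠ _) ⊠ _) ∘ _]compmA -interchange_nat interchange_unit comp1m.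
rewrite tensormE -/(pair_mor _ _) -/(pair_mor _ _) -runit_invE -lunit_invE.
by rewrite tensormE runit_invK lunit_invK tensorm1.
Qed.

(** * Tuples and their finite permutations *)

Lemma tuple_pairS A (X : nat -> C) (f : forall i, A ~> X i) n :
  tuple_mor f n.+1 = pair_mor (tuple_mor f n) (f n.+1).
Proof. exact: tupleS. Qed.

Lemma tuple0 A (X : nat -> C) (f : forall i, A ~> X i) : tuple_mor f 0 = f 0.
Proof. exact: compm1. Qed.

Lemma tuple_comp A B (X : nat -> C) (f : forall i, B ~> X i) (h : A ~> B) n :
  copyable h -> tuple_mor f n ∘ h = tuple_mor (fun i => f i ∘ h) n.
Proof.
move=> ch; elim: n => [|n IHn]; first by rewrite !tuple0.
by rewrite !tuple_pairS pair_comp // IHn.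
Qed.

Lemma copyable_tuple A (X : nat -> C) (f : forall i, A ~> X i) n :
  (forall i, copyable (f i)) -> copyable (tuple_mor f n).
Proof.
move=> cf; elim: n => [|n IHn]; first by rewrite tuple0; apply: cf.
by rewrite tuple_pairS; apply: copyable_pair.
Qed.

Lemma eq_tuple A (X : nat -> C) (f g : forall i, A ~> X i) n :
  (forall i, i <= n -> f i = g i) -> tuple_mor f n = tuple_mor g n.
Proof.
elim: n => [|n IHn] fg; first by rewrite !tuple0 fg.
by rewrite !tuple_pairS (fg n.+1) // IHn // => i le_in; apply/fg/leqW.
Qed.

(** The comparison [b] is a reassociation, hence independent of [f]; this
    uniformity is what lets an equation for long blocks of i.i.d. copies be
    transferred to pairs of blocks. *)
Lemma fpow_pair X n m :
  exists b : prefix (fun=> X) (n + m).+1 ~> prefix (fun=> X) n ⊗ prefix (fun=> X) m,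
  forall A (f : A ~> X), pair_mor (fpow f n) (fpow f m) = b ∘ fpow f (n + m).+1.
Proof.
elim: m => [|m [b bE]].
  rewrite addn0; exists (idm _) => A f.
  by rewrite comp1m /fpow tuple0 tuple_pairS.
rewrite addnS; exists (assoc _ _ _ ∘ (b ⊠ idm X)) => A f.
rewrite {2}/fpow tuple_pairS -assoc_pair -/(fpow f m) bE.
by rewrite /fpow [in RHS]tuple_pairS -compmA tensor_pair comp1m.
Qed.

Definition swap_at a i := if i == a then a.+1 else if i == a.+1 then a else i.

Lemma swap_at_lt a i : i < a -> swap_at a i = i.
Proof. by rewrite /swap_at => lt; rewrite !ltn_eqF // ltnW. Qed.

Lemma swap_at_gt a i : a.+1 < i -> swap_at a i = i.
Proof. by rewrite /swap_at => lt; rewrite !gtn_eqF // ltnW. Qed.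

Lemma swap_atL a : swap_at a a = a.+1.
Proof. by rewrite /swap_at eqxx. Qed.

Lemma swap_atR a : swap_at a a.+1 = a.
Proof. by rewrite /swap_at gtn_eqF // eqxx. Qed.

Lemma swap_atK a : involutive (swap_at a).
Proof.
move=> i; case: (ltngtP i a) => [lt|gt|->].
- by rewrite !swap_at_lt.
- move: gt; rewrite leq_eqVlt => /orP[/eqP <-|gt].
    by rewrite swap_atR swap_atL.
  by rewrite !swap_at_gt.
- by rewrite swap_atL swap_atR.
Qed.

(** The components share only their source, so coassociativity and commutativity
    of [copy] turn the swap into a reassociated braiding of the output. *)
Lemma tuple_swap X a n : a < n ->
  exists b : prefix (fun=> X) n ~> prefix (fun=> X) n,
  forall A (k : nat -> A ~> X),
    tuple_mor (fun i => k (swap_at a i)) n = b ∘ tuple_mor k n.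
Proof.
elim: n => // n IHn; rewrite ltnS leq_eqVlt => /orP[/eqP {IHn}->|lt_an].
  case: n => [|n].
    exists (braid X X) => A k.
    by rewrite !tuple_pairS !tuple0 swap_atL swap_atR braid_pair.
  exists (assoc_inv _ _ _ ∘ (idm _ ⊠ braid X X) ∘ assoc _ _ _) => A k.
  rewrite !tuple_pairS swap_atL swap_atR -!compmA assoc_pair tensor_pair.
  rewrite braid_pair comp1m assoc_inv_pair; do 2!congr pair_mor.
  by apply: eq_tuple => i le_in; rewrite swap_at_lt.
have [b bE] := IHn lt_an; exists (b ⊠ idm X) => A k.
by rewrite !tuple_pairS swap_at_gt // bE tensor_pair comp1m.
Qed.

Definition fixes_from N (s : nat -> nat) := forall i, N <= i -> s i = i.

(** A finite permutation acts on tuples through a morphism [b] of the output that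
    does not depend on the components. Applied to the marginals of X^N this
    computes the permutation action on X^N; applied to a constant family it
    shows that [b] fixes f^(n). The proof moves the preimage [a] of the last
    displaced index upwards by adjacent transpositions. *)
Lemma tuple_perm X N (s : nat -> nat) n :
  bijective s -> fixes_from N s -> N <= n.+1 ->
  exists b : prefix (fun=> X) n ~> prefix (fun=> X) n,
  forall A (k : nat -> A ~> X),
    tuple_mor (fun i => k (s i)) n = b ∘ tuple_mor k n.
Proof.
elim: N s => [|N IHN] s bs fs le_Nn.
  by exists (idm _) => A k; rewrite comp1m; apply: eq_tuple => i _; rewrite fs.
have [a sa]: exists a, s a = N by have [t _ ts] := bs; exists (t N); rewrite ts.
have le_aN : a <= N.
  rewrite leqNgt; apply/negP => lt_Na.
  by have := lt_Na; rewrite -(fs _ lt_Na) sa ltnn.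
move: {2}(N - a) (erefl (N - a)) => d; elim: d a s bs fs sa le_aN => [|d IHd].
  move=> a s bs fs sa le_aN /eqP; rewrite -/(leq N a) => le_Na.
  have aN : a = N by apply/eqP; rewrite eqn_leq le_aN.
  apply: IHN (bs) _ (ltnW le_Nn) => i; rewrite leq_eqVlt => /orP[/eqP <-|].
    by rewrite -[in LHS]aN.
  exact: fs.
move=> a s bs fs sa le_aN Nad.
have lt_aN : a < N by rewrite -subn_gt0 Nad.
have [|||||b bE] := IHd a.+1 (fun i => s (swap_at a i)).
- exact: bij_comp bs (Bijective (swap_atK a) (swap_atK a)).
- by move=> i le_Ni; rewrite swap_at_gt ?fs // (leq_ltn_trans _ le_Ni).
- by rewrite swap_atR.
- exact: lt_aN.
- by rewrite subnS Nad.
have [c cE] := tuple_swap X (leq_trans lt_aN (le_Nn : N <= n)).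
exists (c ∘ b) => A k; rewrite -compmA -bE -cE; apply: eq_tuple => i _.
by rewrite swap_atK.
Qed.

(** * Kolmogorov products *)

Lemma kproj_factor (X : nat -> C) (K : kolmogorov_product X) n k : n <= k ->
  exists d, kproj K n = d ∘ kproj K k.
Proof.
move=> /subnK <-; elim: (k - n) => [|j [d ->]].
  by exists (idm _); rewrite comp1m.
by exists (d ∘ prefix_del X (j + n)); rewrite -compmA (lim_cone (klim K)).
Qed.

Lemma kproj_monic_from (X : nat -> C) (K : kolmogorov_product X) N A
    (u v : A ~> K) :
  (forall n, N <= n -> kproj K n ∘ u = kproj K n ∘ v) -> u = v.
Proof.
move=> uv; apply: (lim_lift_uniq (klim K)) => n.
have [d ->] := kproj_factor K (leq_addl N n).
by rewrite -!compmA uv // leq_addr.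
Qed.

(** Preservation of the limit by tensoring is used once in each factor, with the
    braiding to bring the second factor to the front. *)
Lemma kproj_tensor_monic (X X' : nat -> C) (K : kolmogorov_product X)
    (K' : kolmogorov_product X') A (u v : A ~> K ⊗ K') :
  (forall n m, (kproj K n ⊠ kproj K' m) ∘ u = (kproj K n ⊠ kproj K' m) ∘ v) ->
  u = v.
Proof.
move=> uv.
have swap m w : (kproj K' m ⊠ idm K) ∘ (braid K K' ∘ w)
    = braid K (prefix X' m) ∘ ((idm K ⊠ kproj K' m) ∘ w).
  by rewrite !compmA braid_nat.
rewrite -[u]comp1m -[v]comp1m -braidK -!compmA; congr (_ ∘ _).
apply: (lim_lift_uniq (klim_tensor K' K)) => m; rewrite !swap.
congr (_ ∘ _); apply: (lim_lift_uniq (klim_tensor K (prefix X' m))) => n.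
by rewrite !compmA !tensormE comp1m compm1.
Qed.

Lemma copyable_kproj (X : nat -> C) (K : kolmogorov_product X) n :
  copyable (kproj K n).
Proof. exact: proj2 (kproj_det K n). Qed.

Lemma copyable_kmarg (X : nat -> C) (K : kolmogorov_product X) n :
  copyable (kmarg K n).
Proof. exact: copyable_comp (copyable_prefix_last _ _) (copyable_kproj _ _). Qed.

(** The projections are copyable, so they are the tuples of their marginals, as
    in a cartesian category. *)
Lemma tuple_kmarg (X : nat -> C) (K : kolmogorov_product X) n :
  tuple_mor (kmarg K) n = kproj K n.
Proof.
elim: n => [|n IHn]; first by rewrite tuple0 /kmarg /= comp1m.
rewrite tuple_pairS IHn -(lim_cone (klim K)) /kmarg.
by rewrite -pair_comp ?pair_del_last ?comp1m //; apply: copyable_kproj.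
Qed.

Lemma kprojE_perm X (K : kolmogorov_power X) s n :
  kproj K n ∘ kperm K s = tuple_mor (fun i => kmarg K (s i)) n.
Proof. exact: lim_liftE. Qed.

Lemma kproj_tensor_monic_diag (X : nat -> C) (K : kolmogorov_product X) A
    (u v : A ~> K ⊗ K) :
  (forall n, (kproj K n ⊠ kproj K n) ∘ u = (kproj K n ⊠ kproj K n) ∘ v) ->
  u = v.
Proof.
move=> uv; apply: kproj_tensor_monic => n m.
have [d ->] := kproj_factor K (leq_addr m n).
have [d' ->] := kproj_factor K (leq_addl n m).
by rewrite !tensorm_comp -!compmA uv.
Qed.

Lemma copyable_kperm X (K : kolmogorov_power X) s : copyable (kperm K s).
Proof.
apply: kproj_tensor_monic_diag => n.
rewrite compmA -copyable_kproj -compmA kprojE_perm.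
rewrite copyable_tuple => [|i]; last exact: copyable_kmarg.
by rewrite compmA tensormE kprojE_perm.
Qed.

(** * Distribution objects *)

Lemma cop_hom_inj A B (f g : cop_hom A B) : sval f = sval g -> f = g.
Proof.
case: f g => [f cf] [g cg] /= fg; case: _ / fg in cg *.
by rewrite (proof_irrelevance _ cf cg).
Qed.

Lemma sharp_samp X (PX : distribution_object X) : sharp PX (samp PX) = cop_id PX.
Proof. exact: flatK. Qed.

(** The Yoneda argument: by naturality the whole bijection is given by [samp]. *)
Lemma flatE X (PX : distribution_object X) A (h : cop_hom A PX) :
  flat h = samp PX ∘ sval h.
Proof.
rewrite -[RHS](sharpK PX) sharp_nat sharp_samp; congr flat.
by apply: cop_hom_inj; rewrite /= comp1m.
Qed.

Lemma samp_sharp X (PX : distribution_object X) A (f : A ~> X) :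
  samp PX ∘ sval (sharp PX f) = f.
Proof. by rewrite -flatE sharpK. Qed.

Lemma samp_inj X (PX : distribution_object X) A (g h : A ~> PX) :
  copyable g -> copyable h -> samp PX ∘ g = samp PX ∘ h -> g = h.
Proof.
move=> cg ch gh.
have /(can_inj (@flatK _ _ PX A)) : flat (exist _ g cg : cop_hom A PX)
    = flat (exist _ h ch) by rewrite !flatE.
exact: (congr1 (fun k : cop_hom A PX => sval k)).
Qed.

(** Distribution objects of X are isomorphic over X through copyable morphisms,
    and precomposing with those commutes with taking powers of [samp]. *)
Lemma jointly_monic_samp X (PX QX : distribution_object X) :
  jointly_monic (fpow (samp PX)) -> jointly_monic (fpow (samp QX)).
Proof.
move=> monicP W g h gh.
pose u := sharp PX (samp QX); pose v := sharp QX (samp PX).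
have vu : sval v ∘ sval u = idm QX.
  apply: (@samp_inj _ QX); [|exact: copyable_id|].
    by apply: copyable_comp; apply: svalP.
  by rewrite compmA !samp_sharp compm1.
have powE n : fpow (samp QX) n = fpow (samp PX) n ∘ sval u.
  rewrite /fpow tuple_comp; last exact: svalP.
  by rewrite /u samp_sharp.
rewrite -[g]comp1m -[h]comp1m -vu -!compmA; congr (_ ∘ _).
by apply: monicP => n; rewrite !compmA -powE gh.
Qed.

End CopyDiscard.

(** * The idempotent of an empirical sampling morphism *)

Section EmpiricalSampling.
Variable C : quasi_markov_category.
Implicit Types A B X Y : C.

Lemma kprojE_pow A X (K : kolmogorov_power X) (f : A ~> X) n :
  kproj K n ∘ kpow K f = fpow f n.
Proof. exact: lim_liftE. Qed.

Lemma kmarg0_kpow A X (K : kolmogorov_power X) (f : A ~> X) :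
  kmarg K 0 ∘ kpow K f = f.
Proof.
rewrite -[RHS](tuple0 (fun=> f)) -/(fpow f 0) -(kprojE_pow K).
by rewrite [kmarg K 0]comp1m.
Qed.

Lemma kpow_comp A B X (K : kolmogorov_power X) (f : B ~> X) (h : A ~> B) :
  copyable h -> kpow K f ∘ h = kpow K (f ∘ h).
Proof.
move=> ch; apply: (lim_lift_uniq (klim K)) => n.
by rewrite compmA !kprojE_pow; apply: tuple_comp.
Qed.

Lemma kperm_kpow A X (K : kolmogorov_power X) (f : A ~> X) s N :
  bijective s -> fixes_from N s -> kperm K s ∘ kpow K f = kpow K f.
Proof.
move=> bs fs; apply: (@kproj_monic_from _ _ _ N) => n le_Nn.
have [b bE] := tuple_perm X bs fs (leqW le_Nn).
rewrite compmA kprojE_perm (bE K) tuple_kmarg -compmA kprojE_pow.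
by rewrite /fpow -bE.
Qed.

Section Sampling.
Variables (X : C) (K : kolmogorov_power X) (es : K ~> X).
Hypothesis es_sampling : empirical_sampling es.
Let e := kpow K es.

(** The defining property of [es] with trivial second factor. *)
Lemma exchangeable_absorb A (f : A ~> K) :
  (forall s N, bijective s -> fixes_from N s -> kperm K s ∘ f = f) -> e ∘ f = f.
Proof.
move=> ff.
have /(proj2 es_sampling) absorb : exchangeable (runit_inv K ∘ f).
  by move=> s bs [N fs]; rewrite compmA runit_inv_nat -compmA (ff s N).
move: absorb; rewrite -/e compmA runit_inv_nat -compmA => absorb.
by rewrite -[LHS]comp1m -[RHS]comp1m -(runit_invK K) -!compmA absorb.
Qed.

Lemma absorb_kpow A (f : A ~> X) : e ∘ kpow K f = kpow K f.
Proof. by apply: exchangeable_absorb => s N; apply: kperm_kpow. Qed.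

Lemma idempotent_kpow_es : idempotent_mor e.
Proof. exact: absorb_kpow. Qed.

(** On finite marginals both sides are pairs of blocks: [fpow_pair] rewrites them
    as one long block of i.i.d. samples, to which [absorb_kpow] applies. This
    one identity yields both the strength of [e] and the copyability of
    [p ∘ kpow K f]. *)
Lemma pair_absorb A (f : A ~> X) :
  (e ⊠ e) ∘ (copy K ∘ kpow K f) = pair_mor (kpow K f) (kpow K f).
Proof.
apply: kproj_tensor_monic => n m; rewrite tensor_pair !kprojE_pow.
rewrite !compmA tensormE /e !kprojE_pow.
have [b bE] := fpow_pair X n m.
rewrite -/(pair_mor _ _) !bE -!(kprojE_pow K) -compmA -[_ ∘ _ ∘ kpow K f]compmA.
by rewrite absorb_kpow.
Qed.

Lemma strong_kpow_es : (e ⊠ e) ∘ copy K ∘ e = (e ⊠ e) ∘ copy K.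
Proof. by rewrite -compmA pair_absorb. Qed.

Lemma balanced_kpow_es : balanced e.
Proof.
have absorb_r : (e ⊠ e) ∘ copy K ∘ e = (idm K ⊠ e) ∘ copy K ∘ e.
  have /(proj2 es_sampling) : exchangeable ((idm K ⊠ e) ∘ copy K ∘ e).
    move=> s bs [N fs].
    have e_perm : e ∘ kperm K s = e.
      rewrite /e kpow_comp; last exact: copyable_kperm.
      by rewrite (proj1 es_sampling) //; exists N.
    rewrite !compmA tensormE compm1 comp1m.
    have -> : kperm K s ⊠ e = (idm K ⊠ e) ∘ (kperm K s ⊠ kperm K s).
      by rewrite tensormE comp1m e_perm.
    rewrite -[_ ∘ _ ∘ copy K]compmA -copyable_kperm -!compmA.
    by rewrite (kperm_kpow K es bs fs).
  by rewrite !compmA tensormE compm1 comp1m.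
rewrite /balanced -absorb_r.
(* By commutativity of [copy], the braiding carries [absorb_r] to its mirror
   image with [e] on the first factor. *)
rewrite -[in LHS](copyC K) -[in RHS](copyC K) !compmA -!braid_nat -!compmA.
by congr (_ ∘ _); rewrite !compmA.
Qed.

(** * The splitting as a distribution object *)

Variables (E : C) (p : K ~> E) (i : E ~> K).
Hypotheses (C_positive : positive C) (eE : e = i ∘ p) (piK : p ∘ i = idm E).

(** Positivity for p i = id says that sampling a sequence by [i] and remembering
    its image under [p] is the same as copying E and applying [i] to one copy;
    with the strength of [e] this makes the empirical distribution a copyable
    function of the sequence. *)
Lemma copyable_retraction : copyable p.
Proof.
have p_e : p ∘ e = p by rewrite eE compmA piK comp1m.
have copyE : copy E = (p ⊠ p) ∘ copy K ∘ i.
  have /C_positive pos : copyable (p ∘ i) by rewrite piK; apply: copyable_id.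
  have := congr1 (fun u => (p ⊠ idm E) ∘ u) pos.
  rewrite piK compmA [X in _ = X]compmA !tensormE !comp1m piK tensorm1 comp1m.
  by rewrite !compmA tensormE compm1 comp1m => ->.
rewrite /copyable copyE -compmA -eE -{1 2}p_e tensorm_comp -!compmA.
by rewrite [(e ⊠ e) ∘ _]compmA strong_kpow_es compmA -tensorm_comp p_e.
Qed.

Let sam : E ~> X := kmarg K 0 ∘ i.

Lemma sam_retraction : sam ∘ p = es.
Proof. by rewrite /sam -compmA -eE kmarg0_kpow. Qed.

(** Both sides agree after precomposition with the split epimorphism [p], where
    copyability of [p] lets it enter the power. *)
Lemma kpow_sam : kpow K sam = i.
Proof.
rewrite -[LHS]compm1 -[RHS]compm1 -piK !compmA kpow_comp.
  by rewrite sam_retraction -eE.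
exact: copyable_retraction.
Qed.

Lemma copyable_sharp A (f : A ~> X) : copyable (p ∘ kpow K f).
Proof.
have i_inj Y (u v : Y ~> E ⊗ E) : (i ⊠ i) ∘ u = (i ⊠ i) ∘ v -> u = v.
  move=> uv; rewrite -[u]comp1m -[v]comp1m -tensorm1 -piK tensorm_comp.
  by rewrite -!compmA uv.
apply: i_inj; rewrite -/(pair_mor _ _) tensor_pair !compmA -eE absorb_kpow.
rewrite -pair_absorb -[_ ∘ copy E ∘ p]compmA copyable_retraction.
by rewrite !compmA tensormE -eE.
Qed.

Lemma sam_sharp A (f : A ~> X) : sam ∘ (p ∘ kpow K f) = f.
Proof.
by rewrite -compmA [i ∘ _]compmA -eE absorb_kpow kmarg0_kpow.
Qed.

Lemma sharp_sam A (h : A ~> E) : copyable h -> p ∘ kpow K (sam ∘ h) = h.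
Proof. by move=> ch; rewrite -kpow_comp // kpow_sam compmA piK comp1m. Qed.

Lemma jointly_monic_sam : jointly_monic (fpow sam).
Proof.
move=> W g h gh; rewrite -[g]comp1m -[h]comp1m -piK -!compmA; congr (_ ∘ _).
by apply: (lim_lift_uniq (klim K)) => n; rewrite -kpow_sam !compmA kprojE_pow.
Qed.

Lemma observational_distribution :
  exists PX : distribution_object X, jointly_monic (fpow (samp PX)).
Proof.
unshelve refine (ex_intro _ (@DistributionObject _ X E
  (fun A f => exist _ (p ∘ kpow K f) (copyable_sharp f))
  (fun A h => sam ∘ sval h) _ _ _) _).
- by move=> A f; apply: sam_sharp.
- by move=> A h; apply/cop_hom_inj/sharp_sam/(svalP h).
- move=> A B f h; apply: cop_hom_inj; rewrite /= -kpow_comp; last exact: svalP.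
  exact: compmA.
- by rewrite /samp /= compm1; apply: jointly_monic_sam.
Qed.

End Sampling.
End EmpiricalSampling.

Theorem theorem4p4 (C : quasi_markov_category)
  (C_positive : positive C)
  (C_sigma_continuous : sigma_continuous C)
  (K : forall X : nat -> C, kolmogorov_product X)
  (C_split : forall (X : C) (e : X ~> X), idempotent_mor e -> balanced e -> splits e)
  (C_es : forall X : C,
     exists es : K (fun _ => X) ~> X, empirical_sampling (K := K (fun _ => X)) es) :
  observationally_representable C /\
  (forall X : C, exists (PX : distribution_object X) (s : PX ~> X),
     sharp PX s = cop_id PX).
Proof.
have obs (X : C) : exists PX : distribution_object X,
    jointly_monic (fpow (samp PX)).
  have [es es_sampling] := C_es X.
  have [E [p [i [eE piK]]]] := C_split _ _ (idempotent_kpow_es es_sampling)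
    (balanced_kpow_es es_sampling).
  exact (observational_distribution es_sampling C_positive eE piK).
split; last by move=> X; have [PX _] := obs X; exists PX, (samp PX); apply: sharp_samp.
split=> [X|X QX]; have [PX monicP] := obs X; first by exists.
exact: jointly_monic_samp monicP.
Qed.
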